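(* Let $X$ be either the group $(\mathbb{R},+)$ or the group $(2^\omega,+_2)$. For every nonempty meagre set $A\subseteq X$ there exists a set $B\subseteq X$ such that $A+B$ does not have the Baire property.
   Context: $(2^\omega,+_2)$ is the Cantor space of infinite binary sequences with its product topology and with coordinate-wise addition modulo $2$; $\mathbb{R}$ carries its usual topology. For $A,B\subseteq X$, $A+B=\{a+b : a\in A,\ b\in B\}$, where $+$ is the group operation of $X$. A set has the Baire property if it differs from an open set by a meagre set. *)

(* Defs.v *)
From HB Require Import structures.
From mathcomp Require Import all_boot all_order all_algebra.
From mathcomp Require Import all_classical all_reals all_analysis.

Set Implicit Arguments.
Unset Strict Implicit.
Unset Printing Implicit Defensive.

Import Order.TTheory GRing.Theory Num.Theory.
Import numFieldNormedType.Exports.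

Local Open Scope classical_set_scope.
Local Open Scope ring_scope.

(* 2^omega as a group: [cantor_space] is [nat -> bool] with the product
   topology; it inherits the pointwise group structure of [nat -> bool], in
   which addition on [bool] is [addb], i.e. addition modulo 2. *)
HB.instance Definition _ := GRing.Zmodule.copy cantor_space (nat -> bool).

Lemma cantor_addE (a b : cantor_space) (n : nat) : (a + b) n = a n (+) b n.
Proof. by []. Qed.

Definition sumset (G : zmodType) (A B : set G) : set G :=
  [set a + b | a in A & b in B].

Definition nowhere_dense (T : topologicalType) (A : set T) : Prop :=
  (closure A)° = set0.

Definition meagre (T : topologicalType) (A : set T) : Prop :=
  exists2 F : nat -> set T,
    forall n, nowhere_dense (F n) & A = \bigcup_n F n.

(* [`+`] between sets is symmetric difference. *)
Definition baire_property (T : topologicalType) (A : set T) : Prop :=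
  exists2 U : set T, open U & meagre (A `+` U).

(* Main.v *)
Require Import Defs.
From HB Require Import structures.
From mathcomp Require Import all_boot all_order all_algebra.
From mathcomp Require Import all_classical all_reals all_analysis.
Import Order.TTheory GRing.Theory Num.Theory.
Import numFieldNormedType.Exports.
Local Open Scope classical_set_scope.
Local Open Scope ring_scope.

(** Let [G] be a regular locally compact abelian group with a dense sequence
    [d], and let [A] be nonempty and covered by nowhere dense sets [F m].  It
    suffices to find [B] and [t] such that

    - [B] is nonmeagre in every nonempty open set, and
    - [t + B] is disjoint from [A + B].

    Indeed, suppose [A + B] differs from an open [V] by a meagre set.  Then [V]
    is nonempty, since [A + B] contains a translate of the nonmeagre [B].  But
    [V] minus [A + B] contains the part of [t + B] in [V], which is nonmeagre:
    a contradiction ([sumset_not_baire]).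

    Disjointness means that no difference [b - b'] of elements of [B] has
    [t + b - b'] in [A].  By Baire's theorem there is a [t] such that no
    [t + (d i - d j)] is in the closure of any [F m] ([far_translate]).
    Fattening [d 0, ..., d n] slightly then gives open sets [O n] with
    [t + x - y] outside [F 0, ..., F n] for all [x, y] in [O n]
    ([dense_separating_sets]).  Fix a nonprincipal ultrafilter on the natural
    numbers and let [B] be the set of all [b] that lie in [O n] for
    ultrafilter-many [n].  Two elements of [B] share infinitely many [O n], so
    [t + b - b'] avoids every [F m].

    That [B] is nonmeagre in an open [W] is an argument of Talagrand's type:
    given nowhere dense sets [M k], one builds two points of [W] outside all
    [M k] such that every large [n] has one of the two in [O n]
    ([two_branches]).  The ultrafilter then contains one of the two index sets,
    so one of the two points is in [B]. *)

(** * Shrinking open sets, and nested open sets *)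

Lemma open_shrink {T : topologicalType} (rT : regular_space T) {J : set T} {x} :
  open J -> J x -> exists P, [/\ open P, P x & closure P `<=` J].
Proof.
move=> oJ Jx; have /rT[V Vx clV] : nbhs x J by exact: open_nbhs_nbhs.
exists V°; split; first exact: open_interior.
  exact: nbhs_singleton (nbhs_interior Vx).
exact: subset_trans (closureS (@interior_subset _ V)) clV.
Qed.

Lemma nowhere_dense_avoid {T : topologicalType} {M J : set T} :
  nowhere_dense M -> open J -> J !=set0 -> J `\` closure M !=set0.
Proof.
move=> ndM oJ [x Jx]; apply: contrapT => JM.
have : (closure M)° x.
  apply: (@filterS _ (nbhs x) _ J); last exact: open_nbhs_nbhs.
  by move=> y Jy; apply: contrapT => My; apply: JM; exists y.
by rewrite ndM.
Qed.

(** The form in which nowhere density enters a nested construction. *)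
Lemma nowhere_dense_shrink {T : topologicalType} {M J : set T} :
  regular_space T -> nowhere_dense M -> open J -> J !=set0 ->
  exists P, [/\ open P, P !=set0 & closure P `<=` J `\` M].
Proof.
move=> rT ndM oJ /(nowhere_dense_avoid ndM oJ)[x JMx].
have oJM : open (J `\` closure M).
  by apply: openI => //; exact: closed_openC (@closed_closure _ _).
have [P [oP Px PJM]] := open_shrink rT oJM JMx.
exists P; split => //; first by exists x.
by move=> y /PJM[Jy nMy]; split => // My; apply: nMy; exact: subset_closure.
Qed.

(** The closures form a decreasing sequence of nonempty closed sets in a compact
    set, and their intersection is that of the sets themselves. *)
Lemma nested_compact_bigcap_neq0 {T : topologicalType} {J : nat -> set T} :
  (forall k, J k !=set0) -> (forall k, closure (J k.+1) `<=` J k) ->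
  compact (closure (J 0%N)) -> \bigcap_k J k !=set0.
Proof.
move=> J0 Jdec cJ.
have Jle m n : (m <= n)%N -> J n `<=` J m.
  elim: n => [|n IHn]; first by rewrite leqn0 => /eqP->.
  rewrite leq_eqVlt => /predU1P[->//|/IHn] sub.
  by apply: subset_trans sub; apply: subset_trans (Jdec n); exact: subset_closure.
have FF : ProperFilter (filter_from [set: nat] J).
  apply: filter_from_proper => [|k _]; last exact: J0.
  apply: filter_from_filter; first by exists 0%N.
  move=> i j _ _; exists (maxn i j) => // x Jx.
  by split; apply: Jle Jx; rewrite ?leq_maxl ?leq_maxr.
have [p [_ clp]] : closure (J 0%N) `&` cluster (filter_from setT J) !=set0.
  by apply: cJ; exists 0%N => //; exact: subset_closure.
exists p => k _; apply: Jdec => V Vp; apply: clp => //.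
by exists k.+1.
Qed.

Lemma interior_finitely_many_open {T : topologicalType} {O : nat -> set T} {x}
    {l} m :
  (forall n, open (O n)) -> (forall n, (l <= n)%N -> O n x) ->
  [set y | forall n, (l <= n < m)%N -> O n y]° x.
Proof.
move=> oO Ox.
have : \forall y \near x, forall i : 'I_m, (l <= i)%N -> O i y.
  apply: filter_forall => i; have [li|_] := boolP (l <= i)%N.
    apply: (@filterS _ (nbhs x) _ (O i)) => //.
    by apply: open_nbhs_nbhs; split => //; exact: Ox.
  exact: filterE.
apply: filterS => y Oy n /andP[ln nm]; exact: Oy (Ordinal nm) ln.
Qed.

(** * Two points that share the work of meeting a sequence of open sets *)

Section TwoBranches.
Context {T : topologicalType} (d : nat -> T) (O : nat -> set T).
Context (rT : regular_space T) (dd : dense (range d)).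
Context (oO : forall n, open (O n))
  (Od : forall i n, (i <= n)%N -> O n (d i)).

(** While [J] is shrunk away from [M], nothing keeps it inside the [O n], and it
    is unknown beforehand how large an [n] must be for the shrunk set to contain
    some [d i] with [i <= n].  Until that happens, [J'] carries the load: its
    point [d j] lies in every [O n] with [n >= l], so [J'] can be cut down to
    the finitely many [O n] in question.  The two sets then exchange roles.
    The final [d j] in [Q'] lets the step be iterated. *)
Lemma two_branches_step {M J J' : set T} {l : nat} : nowhere_dense M ->
  open J -> J !=set0 -> open J' -> (exists2 j, (j <= l)%N & J' (d j)) ->
  exists Q Q' m, [/\ open Q, Q !=set0, open Q' &
    exists2 j, (j <= m)%N & Q' (d j)] /\
    [/\ closure Q `<=` J `\` M, closure Q' `<=` J' `\` M, (l < m)%N &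
      forall n, (l <= n < m)%N -> Q `<=` O n \/ Q' `<=` O n].
Proof.
move=> ndM oJ J0 oJ' [j jl J'j].
(* [J] leaves [M]; meanwhile [J'] stays in [O n] for [l <= n < l']. *)
have [P [oP P0 clP]] := nowhere_dense_shrink rT ndM oJ J0.
have [x [Pi [i _ dix]]] := dd _ P0 oP; rewrite -dix {x dix} in Pi.
pose l' := maxn l i.
pose P' := J' `&` [set y | forall n, (l <= n < l')%N -> O n y]°.
have oP' : open P' by apply: openI => //; exact: open_interior.
have P'0 : P' !=set0.
  exists (d j); split=> //; apply: interior_finitely_many_open => // n ln.
  by apply: Od; exact: leq_trans jl ln.
(* Exchanged roles: [P'] leaves [M]; [P] stays in [O n] for [l' <= n < m]. *)
have [Q' [oQ' Q'0 clQ']] := nowhere_dense_shrink rT ndM oP' P'0.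
have [x [Q'k [k _ dkx]]] := dd _ Q'0 oQ'; rewrite -dkx {x dkx} in Q'k.
(* The successor makes the bounds of iterated steps strictly increasing. *)
pose m := (maxn l' k).+1.
pose Q := P `&` [set y | forall n, (l' <= n < m)%N -> O n y]°.
exists Q, Q', m; split; split => //.
- by apply: openI => //; exact: open_interior.
- exists (d i); split=> //; apply: interior_finitely_many_open => // n ln.
  by apply: Od; apply: leq_trans ln; rewrite leq_maxr.
- by exists k => //; rewrite leqW// leq_maxr.
- exact: subset_trans (closureS (@subIsetl _ _ _)) clP.
- by move=> y /clQ'[[J'y _] My].
- by rewrite ltnS (leq_trans (leq_maxl l i))// leq_maxl.
- move=> n /andP[ln nm]; have [l'n|nl'] := leqP l' n.
    by left=> y [_ /interior_subset]; apply; rewrite l'n.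
  right=> y /subset_closure /clQ'[[_ /interior_subset Oy] _].
  by apply: Oy; rewrite ln.
Qed.

(** A single point off all [M k] may lie in [O n] for few [n] only: nothing
    controls how long an escape from [M k] takes.  Two points escape in turn. *)
Lemma two_branches (M : nat -> set T) (W : set T) :
  locally_compact [set: T] -> (forall k, nowhere_dense (M k)) ->
  open W -> W !=set0 ->
  exists b b', [/\ W b, W b', forall k, ~ M k b /\ ~ M k b' &
    exists l, forall n, (l <= n)%N -> O n b \/ O n b'].
Proof.
move=> lcT ndM oW [w Ww].
have [W0 [oW0 W0w clW0 cW0]] : exists W0, [/\ open W0, W0 w,
    closure W0 `<=` W & compact (closure W0)].
  have [//|V] := lcT w; rewrite withinET => Vw [cV clV].
  have [||W0 [oW0 W0w clW0]] := @open_shrink _ rT (W `&` V°) w.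
  - by apply: openI => //; exact: open_interior.
  - by split=> //; exact: nbhs_singleton (nbhs_interior Vw).
  exists W0; split=> //; first exact: subset_trans clW0 (@subIsetl _ _ _).
  apply: subclosed_compact cV _; first exact: closed_closure.
  by move=> y /clW0[_ /interior_subset].
have [x [W0i [i _ dix]]] := dd W0 (ex_intro _ w W0w) oW0.
rewrite -dix {x dix} in W0i.
(* In a state [(J, J', l, k)], [l] bounds the indices already treated and [k]
   counts the nowhere dense sets already avoided. *)
pose good (s : set T * set T * nat * nat) := let: (J, J', l, _) := s in
  [/\ open J, J !=set0, open J' & exists2 j, (j <= l)%N & J' (d j)].
pose next (s t : {s | good s}) :=
  let: (J, J', l, k) := sval s in let: (Q, Q', m, k') := sval t in
  k' = k.+1 /\ [/\ closure Q `<=` J `\` M k, closure Q' `<=` J' `\` M k,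
    (l < m)%N & forall n, (l <= n < m)%N -> Q `<=` O n \/ Q' `<=` O n].
have nextP s : {t | next s t}.
  apply: cid; case: s => -[[[J J'] l] k] [oJ J0 oJ' J'd].
  have [Q [Q' [m [gQ rQ]]]] := two_branches_step (ndM k) oJ J0 oJ' J'd.
  by exists (exist good (Q, Q', m, k.+1) gQ).
have g0 : good (W0, W0, i, 0%N) by split => //; [exists w|exists i].
have [s [s0 sS]] := dependent_choice nextP (exist good _ g0).
pose J k := (sval (s k)).1.1.1; pose J' k := (sval (s k)).1.1.2.
pose l k := (sval (s k)).1.2.
have sk k : (sval (s k)).2 = k.
  elim: k => [|k IHk]; first by rewrite s0.
  have := sS k; rewrite /next; move: IHk.
  by case: (sval (s k)) => [[[? ?] ?] ?]; case: (sval (s _)) => [[[? ?] ?] ?] /= -> [->].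
have {sS}step k : [/\ closure (J k.+1) `<=` J k `\` M k,
    closure (J' k.+1) `<=` J' k `\` M k, (l k < l k.+1)%N &
    forall n, (l k <= n < l k.+1)%N -> J k.+1 `<=` O n \/ J' k.+1 `<=` O n].
  have := sS k; rewrite /next /J /J' /l; move: (sk k).
  by case: (sval (s k)) => [[[? ?] ?] ?]; case: (sval (s _)) => [[[? ?] ?] ?] /= -> [].
have J0 k : J k !=set0.
  by have := svalP (s k); rewrite /J; case: (sval (s k)) => -[[? ?] ?] ? [].
have J'0 k : J' k !=set0.
  have := svalP (s k); rewrite /J'; case: (sval (s k)) => -[[? ?] ?] ? /=.
  by move=> [_ _ _ [j _ ?]]; exists (d j).
have [||b Jb] := nested_compact_bigcap_neq0 J0.
- by move=> k; have [+ _ _ _] := step k; move/subset_trans; apply; exact: subDsetl.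
- by rewrite /J s0.
have [||b' J'b] := nested_compact_bigcap_neq0 J'0.
- by move=> k; have [_ + _ _] := step k; move/subset_trans; apply; exact: subDsetl.
- by rewrite /J' s0.
exists b, b'; split.
- by apply/clW0/subset_closure; have := Jb 0%N I; rewrite /J s0.
- by apply/clW0/subset_closure; have := J'b 0%N I; rewrite /J' s0.
- move=> k; have [clJ clJ' _ _] := step k.
  have /subset_closure/clJ[_] := Jb k.+1 I.
  by have /subset_closure/clJ'[_] := J'b k.+1 I.
- exists (l 0%N) => n ln.
  have lge k : (k <= l k)%N.
    by elim: k => // k IHk; have [_ _ lk _] := step k; exact: leq_ltn_trans lk.
  have [K] : exists K, (n < l K)%N by exists n.+1; exact: lge.
  elim: K => [|k IHk nk]; first by rewrite ltnNge ln.
  have [/IHk//|lkn] := ltnP n (l k).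
  have [_ _ _ /(_ n)] := step k; rewrite lkn nk => -[//|sub|sub].
  + by left; exact: sub (Jb _ I).
  + by right; exact: sub (J'b _ I).
Qed.

End TwoBranches.

(** * The construction in a separable locally compact group *)

Section SeparableGroup.
Context {G : topologicalZmodType} (d : nat -> G).
Context (rG : regular_space G) (lcG : locally_compact [set: G]).
Context (dd : dense (range d)).

Lemma translate_continuous (g : G) : continuous (fun x : G => x + g).
Proof.
move=> x; apply: (@continuous_comp _ _ _ (fun x => (x, g)) (fun p => p.1 + p.2)).
  by apply: cvg_pair; [exact: cvg_id|exact: cvg_cst].
exact: add_continuous.
Qed.

Lemma open_translate (W : set G) g : open W -> open [set x | W (x + g)].
Proof. by move=> oW; apply: open_comp => // x _; exact: translate_continuous. Qed.

Lemma nowhere_dense_translate (M : set G) g :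
  nowhere_dense M -> nowhere_dense [set x | M (x + g)].
Proof.
move=> ndM; rewrite /nowhere_dense -subset0 => x Wx.
have [||y [Wy nMy]] := @nowhere_dense_avoid _ _
    [set y | (closure [set x | M (x + g)])° (y - g)] ndM.
- exact/open_translate/open_interior.
- by exists (x + g) => /=; rewrite addrK.
have /interior_subset clMy := Wy.
have [|z [/= Mz nMz]] := clMy [set z | (~` closure M) (z + g)].
  apply: open_nbhs_nbhs; split; last by rewrite /= subrK.
  exact/open_translate/closed_openC/closed_closure.
by apply: nMz; exact: subset_closure.
Qed.

(** The excluded [t] form a countable union of translates of the nowhere dense
    sets [closure (F m)]. *)
Lemma far_translate (F : nat -> set G) : (forall m, nowhere_dense (F m)) ->
  exists t, forall i j m, ~ closure (F m) (t + (d i - d j)).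
Proof.
move=> ndF.
pose M k := if @unpickle (nat * nat * nat)%type k is Some (i, j, m)
  then [set t | closure (F m) (t + (d i - d j))] else set0.
have ndM k : nowhere_dense (M k).
  rewrite /M; case: unpickle => [[[i j] m]|]; last first.
    by rewrite /nowhere_dense closure0 -subset0; exact: interior_subset.
  apply: nowhere_dense_translate.
  by rewrite /nowhere_dense -(closure_id _).1 //; [exact: ndF|exact: closed_closure].
(* With [O n] the whole space, [two_branches] is Baire's theorem. *)
have [|t [t' [_ _ tM _]]] := two_branches d (fun=> setT) rG dd
  (fun=> openT) (fun _ _ _ => I) M setT lcG ndM openT.
  by exists 0.
exists t => i j m clF; have [+ _] := tM (pickle (i, j, m)).
by rewrite /M pickleK.
Qed.

(** The set [O n] is the union of the translates [d i + V n], [i <= n], for a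
    small neighbourhood [V n] of 0.  Only finitely many conditions bear on
    [V n], and each holds near 0 since the [closure (F m)] are closed. *)
Lemma dense_separating_sets (F : nat -> set G) t :
  (forall i j m, ~ closure (F m) (t + (d i - d j))) ->
  exists O : nat -> set G, [/\ forall n, open (O n),
    forall i n, (i <= n)%N -> O n (d i) &
    forall m n x y, (m <= n)%N -> O n x -> O n y -> ~ F m (t + x - y)].
Proof.
move=> tF.
have /choice[V VP] n : exists V : set G, [/\ open V, V 0 &
    forall i j m v w, (i <= n)%N -> (j <= n)%N -> (m <= n)%N -> V v -> V w ->
      ~ F m (v - w + (t + (d i - d j)))].
  have : \forall p \near ((0, 0) : G * G), forall q : 'I_n.+1 * 'I_n.+1 * 'I_n.+1,
      ~ closure (F q.2) (p.1 - p.2 + (t + (d q.1.1 - d q.1.2))).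
    apply: (@filter_forall _ _ _ (nbhs ((0, 0) : G * G))) => -[[i j] m] /=.
    apply: (@continuous_comp _ _ _ (fun p : G * G => p.1 - p.2)
      (fun z => z + (t + (d i - d j))) _ _ _ (~` closure (F m))).
    - exact: sub_continuous.
    - exact: translate_continuous.
    - apply: open_nbhs_nbhs; split; first exact/closed_openC/closed_closure.
      by rewrite /= subrr add0r; exact: tF.
  move=> -[[A B] /= [A0 B0] AB].
  exists (A `&` B)°; split; first exact: open_interior.
    by apply: nbhs_singleton; apply: nbhs_interior; exact: filterI.
  move=> i j m v w ile jle mle /interior_subset[Av _] /interior_subset[_ Bw] Fm.
  have := AB (v, w) (conj Av Bw)
    (@Ordinal n.+1 i ile, @Ordinal n.+1 j jle, @Ordinal n.+1 m mle).
  by apply; exact: subset_closure.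
exists (fun n => \bigcup_(i in [set i | (i <= n)%N]) [set x | V n (x - d i)]); split.
- move=> n; apply: bigcup_open => i _; have [oV _ _] := VP n.
  exact: open_translate.
- by move=> i n ile; have [_ V0 _] := VP n; exists i => //=; rewrite subrr.
- move=> m n x y mn [i /= ile Vx] [j /= jle Vy]; have [_ _ VF] := VP n.
  have := VF i j m _ _ ile jle mn Vx Vy; congr (~ F m _).
  rewrite opprB addrCA -[RHS]addrA; congr (t + _).
  by rewrite addrC addrA [d i - d j + _]addrC !subrKA.
Qed.

(** The ultrafilter property is used twice: sets in [U] meet beyond any [m],
    which keeps [t + b - b'] off every [F m]; and [U] contains one of any two
    sets with cofinite union, which puts one of two branches into [B]. *)
Lemma sumset_not_baire (A : set G) : A !=set0 -> meagre A ->
  exists B : set G, ~ baire_property (sumset A B).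
Proof.
move=> [a Aa] [F ndF AF].
have [t tavoid] := far_translate F ndF.
have [D [oD Dd DF]] := dense_separating_sets F t tavoid.
have [U [UU subU]] := ultraFilterLemma eventually_filter.
pose B := [set b | U [set n | D n b]].
(* [B] is nonmeagre in every nonempty open set. *)
have Bnm (M : nat -> set G) W : (forall k, nowhere_dense (M k)) ->
    open W -> W !=set0 -> exists b, [/\ B b, W b & forall k, ~ M k b].
  move=> ndM oW W0.
  have [b [b' [Wb Wb' bM [l lD]]]] := two_branches d D rG dd oD Dd M W lcG ndM oW W0.
  have [Bb|nBb] := in_ultra_setVsetC [set n | D n b] UU.
    by exists b; split => // k; have [] := bM k.
  exists b'; split => //; last by move=> k; have [] := bM k.
  have Ul : U [set n | (l <= n)%N] by apply: subU; exists l.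
  by apply: filterS2 nBb Ul => n nDb /lD[].
have BAB b : B b -> ~ sumset A B (b + t).
  move=> Bb [x + [b' Bb' eqb]]; rewrite AF => -[m _ Fx].
  have Um : U [set n | (m <= n)%N] by apply: subU; exists m.
  have [n [[Db Db'] mn]] := filter_ex (filterI (filterI Bb Bb') Um).
  apply: (DF m n b b' mn Db Db').
  by rewrite [t + b]addrC -eqb addrK.
exists B => -[V oV [N ndN VN]].
(* [t + B] is nonmeagre in a nonempty [V]; if [V] is empty, then the translate
   of [B] by [a] shows that [A + B] is not meagre. *)
have [[v Vv]|V0] := pselect (V !=set0).
  have [|||b [Bb Vb Nb]] := Bnm (fun k => [set x | N k (x + t)]) [set x | V (x + t)].
  - by move=> k; exact: nowhere_dense_translate.
  - exact: open_translate.
  - by exists (v - t) => /=; rewrite subrK.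
  have : (sumset A B `+` V) (b + t) by right; split => //; exact: BAB.
  by rewrite VN => -[k _]; exact: Nb.
have [|||b [Bb _ Nb]] := Bnm (fun k => [set x | N k (x + a)]) setT.
- by move=> k; exact: nowhere_dense_translate.
- exact: openT.
- by exists 0.
have : (sumset A B `+` V) (b + a).
  left; split; first by exists a => //; exists b => //; rewrite addrC.
  by move=> Vba; apply: V0; exists (b + a).
by rewrite VN => -[k _]; exact: Nb.
Qed.

End SeparableGroup.

(** * The real line and the Cantor space *)

Lemma cantor_sub_continuous :
  continuous (fun x : cantor_space * cantor_space => x.1 - x.2).
Proof.
move=> x; apply/(@pointwise_cvgP nat bool) => n.
have nth_near (y : cantor_space) : \forall z \near y, z n = y n.
  apply: (@proj_continuous nat (fun=> bool) n y [set b | b = y n]).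
  exact/principal_filterP.
have : \forall y \near x, y.1 n = x.1 n /\ y.2 n = x.2 n.
  exists ([set y | y n = x.1 n], [set y | y n = x.2 n]) => //=.
  by split; exact: nth_near.
move=> xn P /= Px.
have {}Px := nbhs_singleton Px.
apply: filterS xn => y [y1 y2].
by rewrite -[X in X y]/[set y | P (y.1 n (+) y.2 n)] /= y1 y2.
Qed.

HB.instance Definition _ :=
  PreTopologicalNmodule_isTopologicalZmodule.Build cantor_space
    cantor_sub_continuous.

(** An enumeration through codes of finite sequences; the default value of [nth]
    extends such a sequence by zeros. *)
Definition finite_support_enum (k : nat) : cantor_space :=
  fun n => nth false (odflt [::] (unpickle k)) n.

Lemma finite_support_enum_dense : dense (range finite_support_enum).
Proof.
move=> W [x Wx] oW.
pose u N : cantor_space := finite_support_enum (pickle (mkseq x N)).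
(* The truncations of [x] converge to [x] coordinatewise. *)
have ux : u @ \oo --> x.
  apply/(@pointwise_cvgP nat bool) => n P /nbhs_singleton Px.
  exists n.+1 => // N /= nN.
  by rewrite /u /finite_support_enum pickleK /= nth_mkseq.
have [N _ uW] := ux W (open_nbhs_nbhs (conj oW Wx)).
by exists (u N); split; [exact: uW (leqnn N)|eexists].
Qed.

Theorem corollary1 (R : realType) :
  (forall A : set R, A !=set0 -> meagre A ->
     exists B : set R, ~ baire_property (sumset A B)) /\
  (forall A : set cantor_space, A !=set0 -> meagre A ->
     exists B : set cantor_space, ~ baire_property (sumset A B)).
Proof.
split=> A.
- pose d k : R := ratr (odflt 0 (unpickle k : option rat)).
  apply: (@sumset_not_baire R d).
  + exact: uniform_regular.
  + exact: locally_compactR.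
  + move=> W W0 oW; have [x [Wx [q _ qx]]] := dense_rat W0 oW.
    by exists x; split=> //; exists (pickle q) => //; rewrite /d pickleK.
- apply: (@sumset_not_baire cantor_space finite_support_enum).
  + exact: uniform_regular.
  + move=> x _; exists setT; first exact: filterT.
    by split; [exact: cantor_space_compact|exact: closedT].
  + exact: finite_support_enum_dense.
Qed.
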